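(* Let $(X,\|\cdot\|)$ be a normed vector space over $\mathbb{R}$ of dimension $d<\infty$, and let $\lambda\ge1$. Put $\kappa=N(64\lambda^{3})+N(8\lambda^{2})\,N_S(16\lambda)$. Let $A\subseteq X$ be an arbitrary set, and with each $a\in A$ associate a set $S(a)\in\mathcal{S}_\lambda(a)$, such that the diameters of the sets $S(a)$, $a\in A$, have a finite upper bound. Then $A$ can be covered by the interiors of sets from at most $\kappa$ subfamilies, each consisting of pairwise disjoint sets: for some $m\le\kappa$ there are pairwise disjoint subsets $A_1,\ldots,A_m$ of $A$ such that $A\subseteq\bigcup_{j=1}^m\bigcup_{a\in A_j}\operatorname{int}(S(a))$ and, for each $j$, the sets in $\{S(a):a\in A_j\}$ are pairwise disjoint.
   Context: $B(a,r)=\{x\in X:\|x-a\|\le r\}$ is the closed ball; $\operatorname{int}(S)$ denotes the interior of $S$. For $\lambda\ge1$ and $a\in X$, $\mathcal{S}_\lambda(a)$ denotes the collection of all sets $S\subseteq X$ for which there exists $r>0$ such that $B(a,r)\subseteq S\subseteq B(a,\lambda r)$ and $S$ is starlike with respect to every $y\in B(a,r)$, i.e. for each $y\in B(a,r)$ and each $x\in S$ the segment $\{\alpha y+(1-\alpha)x:0\le\alpha\le1\}$ is contained in $S$. For each $\gamma\ge1$, $N(\gamma)$ is an upper bound for the number of points that can be packed into the closed ball $B(0,1)$ when the distance between distinct points is at least $1/\gamma$ and one point is at $0$; $N_S(\gamma)$ is the similar constant (upper bound for the number of points with pairwise distances at least $1/\gamma$) when all points are on the surface $\{\|x\|=1\}$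 of $B(0,1)$. *)

(* Defs.v *)
From HB Require Import structures.
From mathcomp Require Import all_boot all_order all_algebra.
From mathcomp Require Import all_classical all_reals all_analysis.

Set Implicit Arguments.
Unset Strict Implicit.
Unset Printing Implicit Defensive.

Import Order.TTheory GRing.Theory Num.Theory numFieldNormedType.Exports.

Local Open Scope classical_set_scope.
Local Open Scope ring_scope.

Section Defs.
Context {R : realType} {X : normedModType R}.

(* The library's [closed_ball] is the closure of an open ball; the two agree
   for [0 < r] by [closed_ballE]. *)
Definition cball (a : X) (r : R) : set X := [set x | `|x - a| <= r].

Definition starlike_wrt (S : set X) (y : X) : Prop :=
  forall x : X, S x ->
    forall alpha : R, 0 <= alpha <= 1 -> S (alpha *: y + (1 - alpha) *: x).

Definition Slambda (lambda : R) (a : X) : set (set X) :=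
  [set S | exists r : R, [/\ 0 < r, cball a r `<=` S, S `<=` cball a (lambda * r)
                           & forall y, cball a r y -> starlike_wrt S y]].

(* In [\bar R], so that unbounded sets have diameter [+oo]; the diameter of
   [set0] is [-oo], but no member of [Slambda lambda a] is empty. *)
Definition diameter (S : set X) : \bar R :=
  ereal_sup [set `|p.1 - p.2|%:E | p in S `*` S].

Definition min_dist_ge (delta : R) (s : seq X) : Prop :=
  {in s &, forall x y, x != y -> delta <= `|x - y|}.

(* The duplicate-free [s] lists a finite set of points; [n] need not be the
   least bound. *)
Definition ball_packing_bound (gamma : R) (n : nat) : Prop :=
  forall s : seq X, uniq s -> 0 \in s -> [set` s] `<=` cball 0 1 ->
    min_dist_ge gamma^-1 s -> (size s <= n)%N.

Definition sphere_packing_bound (gamma : R) (n : nat) : Prop :=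
  forall s : seq X, uniq s -> [set` s] `<=` [set x : X | `|x| = 1] ->
    min_dist_ge gamma^-1 s -> (size s <= n)%N.

End Defs.

Arguments ball_packing_bound {R} X gamma n.
Arguments sphere_packing_bound {R} X gamma n.

Definition kappa {R : realType} (N NS : R -> nat) (lambda : R) : nat :=
  (N (64 * lambda ^+ 3)%R + N (8 * lambda ^+ 2)%R * NS (16 * lambda)%R)%N.

(* Main.v *)
(**
  Every S(a) has an inner radius r(a), and these radii are bounded.  Order A by
  the dyadic scale of r(a), large sets first, breaking ties by a well-order, and
  select a greedily unless it lies in int S(b) for a selected b before it.  The
  sets of selected points cover A, and a greedy colouring along the same order
  uses at most kappa colours provided that fewer than kappa of the selected
  points a before p have S(a) meeting S(p).

  Fix p and such points a.  Those with |a - p| <= 8 lambda^2 r(p) are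
  r(p)/2-separated, so there are fewer than N(64 lambda^3) of them.  Group the
  others by their direction from p into at most N_S(16 lambda) clusters of
  angular diameter less than 1/(8 lambda).  If m is the farthest point of a
  cluster, then S(m) is starlike, reaches S(p), and hence contains the whole
  cluster in its interior.  So m comes last in its cluster, all radii there are
  at least r(m)/2, and after rescaling by |m - p| the cluster is a packing of
  the unit ball, with fewer than N(8 lambda^2) points.
*)
Require Import Defs.
From HB Require Import structures.
From mathcomp Require Import all_boot all_order all_algebra.
From mathcomp Require Import all_classical all_reals all_analysis.
From mathcomp Require Import wochoice ring lra.

Import Order.TTheory GRing.Theory Num.Theory numFieldNormedType.Exports.

Local Open Scope classical_set_scope.
Local Open Scope ring_scope.

(** * Well-founded orders, greedy selection and greedy colouring *)

(** Compare levels first and break ties by a well-order of [T]. Among the inaccessible points of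
    least level, the one least in the well-order would be accessible after all. *)
Lemma level_wf_order (T : eqType) (l : T -> nat) :
  exists prec : T -> T -> Prop,
    [/\ well_founded prec,
        forall a b, a != b -> prec a b \/ prec b a
      & forall a b, prec a b -> (l a <= l b)%N].
Proof.
have [R R_wo] := well_ordering_principle T.
have R_total : {in predT &, total R}.
  by apply: wo_chainW => A _; exact: R_wo.
pose prec a b := (l a < l b)%N \/ [/\ l a = l b, R a b & a != b].
exists prec; split.
- move=> x0; apply: contrapT => x0NAcc; pose bad x := ~ Acc prec x.
  have ex_lev : exists n, `[< exists2 x, bad x & l x = n >].
    by exists (l x0); apply/asboolP; exists x0.
  case: (ex_minnP ex_lev) => n /asboolP[x x_bad lxn] n_min.
  pose minbad := [pred y | `[< bad y /\ l y = n >]].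
  have minbad_n0 : nonempty minbad by exists x; rewrite inE.
  have [z [[+ z_min] _]] := R_wo minbad minbad_n0.
  rewrite inE => -[z_bad lzn].
  apply: z_bad; constructor => y y_lt_z.
  apply: contrapT => y_bad.
  have n_le_ly : (n <= l y)%N by apply: n_min; apply/asboolP; exists y.
  case: y_lt_z => [|[lyz Ryz /eqP]]; first by rewrite lzn ltnNge n_le_ly.
  apply; have Rzy : R z y.
    by apply: z_min; rewrite inE; split; rewrite // lyz.
  apply: (wo_chain_antisymmetric (C := predT) (fun A _ => R_wo A)) => //.
  by rewrite Ryz.
- move=> a b ab; case: (ltngtP (l a) (l b)) => lab; [by left; left|by right; left|].
  have /orP[Rab|Rba] := R_total a b isT isT; [left|right]; right; split=> //.
  by rewrite eq_sym.
- by move=> a b [/ltnW //|[-> _ _]].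
Qed.

(** Passing to [F] the graph of [f] below [a], as a relation, keeps proofs of [prec b a] out of the
    recursion equation. *)
Lemma wf_recursion (T U : Type) (prec : T -> T -> Prop) (F : T -> (T -> U -> Prop) -> U) :
  well_founded prec ->
  exists f : T -> U, forall a, f a = F a (fun b u => prec b a /\ f b = u).
Proof.
move=> wf.
pose G a (f : forall b, prec b a -> U) := F a (fun b u => exists h : prec b a, f b h = u).
exists (Fix wf (fun=> U) G) => a; rewrite Fix_eq => [|x f g fg].
  rewrite /G; congr F; apply/funext => b; apply/funext => u; apply/propext.
  by split=> [[]|[h <-]]; [|exists h].
by congr G; apply: functional_extensionality_dep => b; apply/funext => h; exact: fg.
Qed.

Lemma wf_kernel (T : Type) (prec hit : T -> T -> Prop) (A : set T) :
  well_founded prec ->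
  exists B : set T, forall a,
    B a <-> A a /\ forall b, prec b a -> B b -> ~ hit b a.
Proof.
move=> wf.
have [B BE] := @wf_recursion T Prop prec
  (* By propositional extensionality, [f b True] says that [b] precedes [a] and is selected. *)
  (fun a f => A a /\ forall b, f b True -> ~ hit b a) wf.
exists B => a; rewrite {1}BE; split=> -[Aa hB]; split=> // b.
  by move=> ba Bb; apply: hB; split=> //; apply/propext.
by move=> [ba Bb]; apply: hB; rewrite ?Bb.
Qed.

(** If no colour were free at [a], choosing a conflicting predecessor of each colour would give [k]
    distinct ones, one more than allowed. *)
Lemma wf_coloring (T : eqType) (prec conflict : T -> T -> Prop) (k : nat) :
  well_founded prec ->
  (forall p s, uniq s -> {in s, forall a, prec a p /\ conflict a p} ->
     (size s < k)%N) ->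
  exists c : T -> nat, (forall a, (c a < k)%N) /\
    forall a b, prec a b -> conflict a b -> c a <> c b.
Proof.
move=> wf few.
pose free a (f : T -> nat -> Prop) :=
  [set n | (n < k)%N /\ forall b, f b n -> ~ conflict b a].
(* The default [0] is never taken, since the set of free colours turns out to be nonempty. *)
have [c cE] := @wf_recursion T nat prec (fun a f => xget 0%N (free a f)) wf.
have c_free a : free a (fun b u => prec b a /\ c b = u) (c a).
  rewrite cE; set Fa := free _ _.
  have [n Fan] : Fa !=set0.
    apply: contrapT => noF.
    have /choice[g gP] (i : 'I_k) :
        exists b, [/\ prec b a, c b = i & conflict b a].
      apply: contrapT => nob; apply: noF; exists (i : nat); split=> // b [ba cb] ab.
      by apply: nob; exists b.
    have g_inj : injective g.
      move=> i j gij; apply: val_inj => /=.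
      by have [_ <- _] := gP i; have [_ <- _] := gP j; rewrite gij.
    have := few a (map g (enum 'I_k)).
    rewrite map_inj_uniq // enum_uniq size_map size_enum_ord ltnn => few_a.
    by suff: false by []; apply: few_a => // b /mapP[i _ ->]; have [] := gP i.
  by apply: xgetPex; exists n.
exists c; split=> [a|a b ab conf cab]; first by have [] := c_free a.
by have [_ /(_ a)] := c_free b; apply.
Qed.

(** * Separated families, clusters and rescaled packings *)

Lemma maximal_separated (R : realType) (X : normedModType R) (delta : R)
    (s : seq X) :
  exists t : seq X, [/\ uniq t, {subset t <= s}, min_dist_ge delta t
    & {in s, forall x, exists2 y, y \in t & x = y \/ `|x - y| < delta}].
Proof.
elim: s => [|x s [t [t_uniq t_sub t_sep t_max]]]; first by exists [::].
have [/hasP[y yt xy]|/hasPn xt] := boolP (has (fun y => (x == y) || (`|x - y| < delta)) t).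
  exists t; split=> // [z /t_sub zs|z]; first by rewrite inE zs orbT.
  rewrite inE => /predU1P[->|/t_max//].
  by exists y => //; case/orP: xy => [/eqP|]; [left|right].
have far_x y : y \in t -> delta <= `|x - y|.
  by move=> /xt; rewrite negb_or -leNgt => /andP[].
exists (x :: t); split.
- rewrite /= t_uniq andbT; apply/negP => /xt; rewrite eqxx//.
- move=> z; rewrite !inE => /predU1P[->|/t_sub ->]; rewrite ?eqxx ?orbT//.
- move=> y z; rewrite !inE => /predU1P[->|yt] /predU1P[->|zt] yz.
  + by rewrite eqxx in yz.
  + exact: far_x.
  + by rewrite distrC; exact: far_x.
  + exact: t_sep.
- move=> z; rewrite inE => /predU1P[->|/t_max[y yt zy]].
    by exists x; [rewrite inE eqxx|left].
  by exists y; rewrite // inE yt orbT.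
Qed.

Lemma size_le_cluster (T U : eqType) (near : T -> U -> bool) (s : seq T)
    (t : seq U) (k : nat) :
  {in s, forall x, exists2 y, y \in t & near x y} ->
  {in t, forall y, (count (near^~ y) s <= k)%N} ->
  (size s <= size t * k)%N.
Proof.
elim: t s => [|y t IHt] s cover few.
  by case: s cover {few} => // x s /(_ x (mem_head _ _))[].
rewrite mulSn -(count_predC (near^~ y) s) leq_add ?few ?mem_head//.
rewrite -size_filter; apply: IHt => [x|z zt].
  rewrite mem_filter /= => /andP[/negP xNy /cover[z]].
  by rewrite inE => /predU1P[->//|]; exists z.
apply: leq_trans (few z _); last by rewrite inE zt orbT.
by rewrite count_filter; apply: sub_count => x /andP[].
Qed.

(** Moving [p] to the origin and dividing by [rho] puts [s] into the unit ball. The inner radius of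
    the annulus leaves room for the extra point [0], which makes the bound strict. *)
Lemma scaled_ball_packing (R : realType) (X : normedModType R) (gamma : R)
    (n : nat) (p : X) (rho : R) (s : seq X) :
  ball_packing_bound X gamma n -> 0 < gamma -> 0 < rho -> uniq s ->
  {in s, forall a, rho / gamma <= `|a - p| <= rho} ->
  min_dist_ge (rho / gamma) s -> (size s < n)%N.
Proof.
move=> packing gamma_gt0 rho_gt0 s_uniq s_annulus s_sep.
pose f a := rho^-1 *: (a - p).
have norm_f a b : `|f a - f b| = rho^-1 * `|a - b|.
  by rewrite -scalerBr normrZ gtr0_norm ?invr_gt0// opprB addrA subrK.
have norm_f0 a : `|f a| = rho^-1 * `|a - p|.
  by rewrite normrZ gtr0_norm ?invr_gt0.
have f_inj : injective f.
  move=> a b /eqP; rewrite -subr_eq0 -normr_eq0 norm_f mulf_eq0 invr_eq0.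
  by rewrite (gt_eqF rho_gt0) /= normr_eq0 subr_eq0 => /eqP.
have lowE x : (gamma^-1 <= rho^-1 * x) = (rho / gamma <= x).
  by rewrite ler_pdivlMl.
have f_low a : a \in s -> gamma^-1 <= `|f a|.
  by move=> /s_annulus /andP[+ _]; rewrite norm_f0 lowE.
have /= := packing (0 :: map f s); rewrite size_map; apply.
- rewrite map_inj_uniq // s_uniq andbT; apply/mapP => -[a /f_low + a0].
  by rewrite -a0 normr0 leNgt invr_gt0 gamma_gt0.
- exact: mem_head.
- move=> x /=; rewrite inE /cball /= subr0 => /predU1P[->|/mapP[a + ->]].
    by rewrite normr0.
  by move=> /s_annulus /andP[_]; rewrite norm_f0 ler_pdivrMl ?mulr1.
- move=> x y; rewrite !inE => /predU1P[->|/mapP[a a_s ->]] /predU1P[->|/mapP[b bs ->]] xy.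
  + by rewrite eqxx in xy.
  + by rewrite sub0r normrN f_low.
  + by rewrite subr0 f_low.
  + by rewrite norm_f lowE s_sep//; apply: contraNneq xy => ->.
Qed.

(** * Interior points of starlike sets *)

(** Contracting the inner ball towards [x] by the factor [t] gives a ball of radius [t * r] inside
    [S]. In the proof, [y] is the preimage of [z] under this contraction. *)
Lemma starlike_cone_interior (R : realType) (X : normedModType R) (S : set X)
    (a x c : X) (r t : R) :
  (forall y, cball a r y -> starlike_wrt S y) -> S x -> 0 < t <= 1 ->
  `|c - (t *: a + (1 - t) *: x)| < t * r -> interior S c.
Proof.
move=> star Sx /andP[t_gt0 t_le1] c_cone; apply/nbhs_normP.
exists (t * r - `|c - (t *: a + (1 - t) *: x)|); first by rewrite /= subr_gt0.
move=> z /= cz; pose y := t^-1 *: (z - (1 - t) *: x).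
have -> : z = t *: y + (1 - t) *: x.
  by rewrite scalerA divff ?gt_eqF// scale1r subrK.
apply: (star y) => //; last by rewrite ltW.
rewrite /cball /= -(ler_pM2l t_gt0) -{1}(gtr0_norm t_gt0) -normrZ scalerBr.
rewrite scalerA divff ?gt_eqF// scale1r.
have -> : z - (1 - t) *: x - t *: a =
    (c - (t *: a + (1 - t) *: x)) - (c - z).
  by rewrite opprB [RHS]addrC addrA subrK opprD addrA addrAC.
by apply: le_trans (ler_normB _ _) _; rewrite -lerBrDl ltW.
Qed.

Lemma seq_argmax (R : realType) (T : eqType) (f : T -> R) (s : seq T) :
  s != [::] -> exists2 m, m \in s & {in s, forall a, f a <= f m}.
Proof.
elim: s => // x [|y s] IHs _.
  by exists x; [exact: mem_head|move=> a; rewrite inE => /eqP ->].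
have [m ms m_max] := IHs isT; have [xm|/ltW mx] := leP (f x) (f m).
  exists m; first by rewrite inE ms orbT.
  by move=> a; rewrite inE => /predU1P[->|/m_max].
exists x; first exact: mem_head.
by move=> a; rewrite inE => /predU1P[->//|/m_max am]; exact: le_trans am mx.
Qed.

(** * Counting the earlier selected sets that meet a given one *)

Section SatelliteConfigurations.
Context {R : realType} {X : normedModType R}.
Implicit Types (S : set X) (a b p x : X) (s : seq X).

(** [Slambda] with its witness exposed, because ordering and estimates must refer to one fixed
    radius for each point. *)
Definition inner_radius (lambda : R) S a (r : R) : Prop :=
  [/\ 0 < r, cball a r `<=` S, S `<=` cball a (lambda * r)
    & forall y, cball a r y -> starlike_wrt S y].

Lemma notin_interior_dist {lambda S a r b} :
  inner_radius lambda S a r -> ~ interior S b -> r <= `|a - b|.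
Proof.
move=> [r_gt0 ball_S _ _] b_out; rewrite leNgt; apply/negP => ab.
apply: b_out; apply/nbhs_normP; exists (r - `|a - b|) => [|z /= bz].
  by rewrite /= subr_gt0.
apply: ball_S; rewrite /cball /= distrC.
apply: le_trans (ler_distD b _ _) _; rewrite -lerBrDl; exact: ltW.
Qed.

Lemma dist_le_reach (lambda q r : R) S b p x :
  inner_radius lambda S b r -> S x -> `|x - p| <= lambda * q ->
  `|b - p| <= lambda * (r + q).
Proof.
move=> [_ _ S_ball _] Sx xp; rewrite mulrDr.
apply: le_trans (ler_distD x _ _) _; apply: lerD => //.
by rewrite distrC; exact: S_ball.
Qed.

Definition direction p a : X := `|a - p|^-1 *: (a - p).

Lemma direction_norm p a : 0 < `|a - p| -> `|direction p a| = 1.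
Proof.
by move=> a_gt0; rewrite normrZ ger0_norm ?invr_ge0// mulVf// gt_eqF.
Qed.

(* Seen from [p], the cone spanned by [x] and the inner ball at [b] contains
   every point in nearly the same direction as [b] that is closer than [b] but
   not too close. *)
Lemma same_direction_interior (lambda q r : R) S a b p x :
  1 <= lambda -> 0 < q -> inner_radius lambda S b r ->
  S x -> `|x - p| <= lambda * q ->
  8 * lambda ^+ 2 * q < `|a - p| -> `|a - p| <= `|b - p| ->
  `|direction p a - direction p b| < (8 * lambda)^-1 ->
  interior S a.
Proof.
move=> l_ge1 q_gt0 S_inner Sx xp a_far ab dir_ab.
have l_gt0 : 0 < lambda by lra.
have B_le := dist_le_reach _ _ _ _ _ _ _ S_inner Sx xp.
case: S_inner => r_gt0 _ _ star.
set A := `|a - p| in a_far ab *; set B := `|b - p| in ab B_le *.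
have A_gt0 : 0 < A by apply: le_lt_trans a_far; rewrite !mulr_ge0 ?exprn_ge0// ltW.
have B_gt0 : 0 < B by exact: lt_le_trans ab.
(* With this [t], the vector [t *: (b - p)] has length [A]. The distance to the cone point then
   splits into an angular error and one from [x] differing from [p]. *)
pose t := A / B.
have t_gt0 : 0 < t by rewrite divr_gt0.
have t_le1 : t <= 1 by rewrite ler_pdivrMr ?mul1r.
apply: (starlike_cone_interior R X S b x a r t) => //; first by rewrite t_gt0.
have -> : a - (t *: b + (1 - t) *: x) =
    A *: (direction p a - direction p b) - (1 - t) *: (x - p).
  rewrite scalerBr !scalerA divff ?gt_eqF// scale1r -/t.
  have -> : t *: b + (1 - t) *: x = p + (t *: (b - p) + (1 - t) *: (x - p)).
    rewrite !scalerBr addrACA -opprD -scalerDl [t + _]addrC subrK scale1r.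
    by rewrite [RHS]addrC subrK.
  by rewrite !opprD !addrA.
(* In units of [w], the angular error is at most [w] and the other at most [lambda * q < w], whereas
   [t * r >= 8 * w - t * q > 7 * w]. *)
pose w := A / (8 * lambda).
have A_w : A = 8 * lambda * w by rewrite mulrC divfK// gt_eqF// mulr_gt0.
have dir_w : `|A *: (direction p a - direction p b)| <= w.
  by rewrite normrZ gtr0_norm// ler_pM2l// ltW.
have x_lq : `|(1 - t) *: (x - p)| <= lambda * q.
  rewrite normrZ ger0_norm ?subr_ge0//; apply: le_trans xp.
  by rewrite ler_piMl// gerBl ltW.
apply: le_lt_trans (ler_normB _ _) _.
apply: le_lt_trans (lerD dir_w x_lq) _.
have w_lq : lambda * q < w by nra.
have tB : t * B = A by rewrite divfK// gt_eqF.
have w_le : 8 * w <= t * (r + q).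
  rewrite -(ler_pM2l l_gt0) mulrA [lambda * 8]mulrC -A_w -tB mulrCA.
  by rewrite ler_pM2l.
nra.
Qed.

Variables (lambda : R) (S : X -> set X) (r : X -> R).
Hypothesis lambda_ge1 : 1 <= lambda.

(** What the counting uses of the greedy order: selection yields the first half, the dyadic levels
    the second. *)
Definition precedes a b : Prop := ~ interior (S a) b /\ r b <= 2 * r a.

Let l_gt0 : 0 < lambda. Proof. exact: lt_le_trans lambda_ge1. Qed.

Lemma precedes_dist {a b} :
  inner_radius lambda (S a) a (r a) -> inner_radius lambda (S b) b (r b) ->
  forall delta, delta <= r a -> delta <= r b ->
  precedes a b \/ precedes b a -> delta <= `|a - b|.
Proof.
move=> Sa Sb delta da db [[b_out _]|[a_out _]].
  exact: le_trans (notin_interior_dist Sa b_out).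
by rewrite distrC; exact: le_trans (notin_interior_dist Sb a_out).
Qed.

Lemma cluster_bound (n : nat) (q : R) p s :
  ball_packing_bound X (8 * lambda ^+ 2) n -> 0 < q -> uniq s ->
  {in s, forall a, inner_radius lambda (S a) a (r a)} ->
  {in s, forall a, ~ interior (S a) p} ->
  {in s, forall a, exists2 x, S a x & `|x - p| <= lambda * q} ->
  {in s &, forall a b, a != b -> precedes a b \/ precedes b a} ->
  {in s, forall a, 8 * lambda ^+ 2 * q < `|a - p|} ->
  {in s &, forall a b, `|direction p a - direction p b| < (8 * lambda)^-1} ->
  (size s < n)%N.
Proof.
move=> packing q_gt0 s_uniq inner p_out reach order far dirs.
have c_gt0 : 0 < 8 * lambda ^+ 2 by rewrite mulr_gt0// exprn_gt0.
(* Even for empty [s] the strict bound asks for [0 < n], which the packing by the origin alone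
   provides. *)
have [s0|s_n0] := eqVneq s [::].
  by apply: (scaled_ball_packing R X _ n p 1 s packing) => //; rewrite s0.
have [m ms m_max] := seq_argmax R _ (fun a => `|a - p|) s s_n0.
set rho := `|m - p| in m_max.
(* This is the separation for the packing at scale [rho]. It suffices that every radius in the
   cluster is at least [w], since [p] and the other points avoid the interiors. *)
pose w := rho / (8 * lambda ^+ 2).
have rhoE : rho = 8 * lambda ^+ 2 * w by rewrite mulrC divfK// gt_eqF.
have q_lt_w : q < w by rewrite ltr_pdivlMr// mulrC far.
have rm_ge : 2 * w <= r m.
  have [x Sx xp] := reach m ms.
  have := dist_le_reach _ _ _ _ _ _ _ (inner m ms) Sx xp.
  rewrite -/rho rhoE expr2 -!mulrA mulrCA ler_pM2l// => mw.
  by have : w <= lambda * w; [rewrite ler_peMl// ltW// (lt_trans q_gt0)|lra].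
have r_ge a : a \in s -> w <= r a.
  move=> a_s; have [->|am] := eqVneq a m; first by lra.
  have [x Sx xp] := reach m ms.
  have am_int : interior (S m) a.
    apply: (same_direction_interior lambda q (r m) _ a m p x) => //;
      [exact: inner|exact: far|exact: m_max|exact: dirs].
  (* As [a] is interior to [S m], [m] cannot precede [a]; hence [a] precedes [m], and
     [2 * w <= r m <= 2 * r a]. *)
  by have [[_]|[]] := order _ _ a_s ms am; [lra|].
apply: (scaled_ball_packing R X _ n p rho s packing) => //.
- by rewrite rhoE mulr_gt0// (lt_trans q_gt0).
- move=> a a_s; rewrite m_max// andbT.
  apply: le_trans (r_ge a a_s) _.
  exact: notin_interior_dist (inner a a_s) (p_out a a_s).
- move=> a b a_s bs ab.
  exact: (precedes_dist (inner a a_s) (inner b bs) _ (r_ge a a_s) (r_ge b bs)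
    (order a b a_s bs ab)).
Qed.

Lemma satellite_bound (N NS : R -> nat) p s :
  (forall gamma, 1 <= gamma -> ball_packing_bound X gamma (N gamma)) ->
  (forall gamma, 1 <= gamma -> sphere_packing_bound X gamma (NS gamma)) ->
  uniq s -> inner_radius lambda (S p) p (r p) ->
  {in s, forall a, inner_radius lambda (S a) a (r a)} ->
  {in s, forall a, precedes a p} ->
  {in s, forall a, S a `&` S p !=set0} ->
  {in s &, forall a b, a != b -> precedes a b \/ precedes b a} ->
  (size s < kappa N NS lambda)%N.
Proof.
move=> N_bound NS_bound s_uniq inner_p inner order_p meet order.
pose q := r p; have q_gt0 : 0 < q by case: inner_p.
have reach a : a \in s -> exists2 x, S a x & `|x - p| <= lambda * q.
  move=> /meet[x [Sax Spx]]; exists x => //.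
  by case: inner_p => _ _ S_ball _; exact: S_ball.
have r_ge a : a \in s -> q / 2 <= r a.
  by move=> /order_p[_]; rewrite -/q; lra.
have dist_p a : a \in s -> r a <= `|a - p|.
  by move=> a_s; apply: notin_interior_dist (inner a a_s) _; case: (order_p a a_s).
pose near a := `|a - p| <= 8 * lambda ^+ 2 * q.
(* The strictness is placed on the near points, so the far ones only need a weak bound. *)
rewrite -(count_predC near) -!size_filter /kappa -addSn leq_add//.
- have g_ge1 : 1 <= 64 * lambda ^+ 3 by have := exprn_ege1 3 lambda_ge1; lra.
  (* The left side equals [q / (8 * lambda)], which is below [q / 2]. *)
  have sep_le a : a \in s -> 8 * lambda ^+ 2 * q / (64 * lambda ^+ 3) <= r a.
    move=> /r_ge; apply: le_trans; rewrite ler_pdivrMr; last by lra.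
    have : lambda ^+ 2 * q <= lambda ^+ 3 * q.
      by rewrite ler_wpM2r ?(ltW q_gt0)// ler_weXn2l.
    have : 0 <= lambda ^+ 3 * q by rewrite mulr_ge0 ?exprn_ge0 ?ltW.
    by lra.
  apply: (scaled_ball_packing R X _ _ p (8 * lambda ^+ 2 * q) _ (N_bound _ g_ge1)).
  + exact: lt_le_trans g_ge1.
  + by rewrite !mulr_gt0// exprn_gt0.
  + exact: filter_uniq.
  + move=> a; rewrite mem_filter => /andP[a_near a_s]; rewrite [X in _ && X]a_near andbT.
    exact: le_trans (sep_le a a_s) (dist_p a a_s).
  + move=> a b; rewrite !mem_filter => /andP[_ a_s] /andP[_ bs] ab.
    exact: (precedes_dist (inner a a_s) (inner b bs) _ (sep_le a a_s)
      (sep_le b bs) (order a b a_s bs ab)).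
- set far := seq.filter _ s.
  have farP a : a \in far -> a \in s /\ 8 * lambda ^+ 2 * q < `|a - p|.
    by rewrite mem_filter /= -ltNge => /andP[].
  (* The members of a maximal separated set of directions serve as cluster centres. Two directions
     within [(16 * lambda)^-1] of one centre are less than [(8 * lambda)^-1] apart. *)
  have [t [t_uniq t_sub t_sep t_max]] :=
    maximal_separated R X (16 * lambda)^-1 (map (direction p) far).
  have t_size : (size t <= NS (16 * lambda)%R)%N.
    have g_ge1 : 1 <= 16 * lambda by rewrite mulr_ege1 ?ler1n.
    apply: (NS_bound _ g_ge1 t t_uniq _ t_sep).
    move=> u /t_sub /mapP[a /farP[a_s _] ->]; apply: direction_norm.
    by apply: lt_le_trans (dist_p a a_s); have := r_ge a a_s; lra.
  rewrite mulnC; apply: leq_trans (leq_mul t_size (leqnn _)).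
  pose near_dir a u := `|direction p a - u| < (16 * lambda)^-1.
  apply: (size_le_cluster _ _ near_dir).
    move=> a a_far; have [|u ut u_near] := t_max (direction p a).
      exact: map_f.
    exists u => //; case: u_near => // au.
    by rewrite /near_dir au subrr normr0 invr_gt0 mulr_gt0.
  move=> u ut; rewrite -size_filter; apply: ltnW.
  set L := seq.filter _ far.
  have LP a : a \in L -> [/\ a \in s, 8 * lambda ^+ 2 * q < `|a - p| & near_dir a u].
    by rewrite mem_filter => /andP[? /farP[]].
  apply: (cluster_bound _ q p) => //.
  + by apply: N_bound; have := exprn_ege1 2 lambda_ge1; lra.
  + by rewrite !filter_uniq.
  + by move=> a /LP[/inner].
  + by move=> a /LP[/order_p[]].
  + by move=> a /LP[/reach].
  + by move=> a b /LP[a_s _ _] /LP[bs _ _]; exact: order.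
  + by move=> a /LP[].
  + move=> a b /LP[_ _ au] /LP[_ _]; rewrite /near_dir distrC => bu.
    apply: le_lt_trans (ler_distD u _ _) _.
    have -> : (8 * lambda)^-1 = (16 * lambda)^-1 + (16 * lambda)^-1.
      by field; rewrite gt_eqF.
    exact: ltrD.
Qed.

End SatelliteConfigurations.

(** * Bounded radii and their dyadic scales *)

(** In the zero space the diameter does not control the radius, so the radius is truncated at
    [Num.max M 1]. The outer inclusion survives because [S] lies within [M] of [a] and
    [1 <= lambda]. *)
Lemma Slambda_bounded_radius (R : realType) (X : normedModType R) (lambda M : R)
    (a : X) (S : set X) :
  1 <= lambda -> Slambda lambda a S -> (diameter S <= M%:E)%E ->
  exists2 r, inner_radius lambda S a r & r <= Num.max M 1.
Proof.
move=> l_ge1 [r [r_gt0 ball_S S_ball star]] diam.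
have Sa : S a by apply: ball_S; rewrite /cball /= subrr normr0 ltW.
have ball_le y : cball a (Num.min r (Num.max M 1)) y -> cball a r y.
  by rewrite /cball /= le_min => /andP[].
exists (Num.min r (Num.max M 1)); last by rewrite ge_min lexx orbT.
split.
- by rewrite lt_min r_gt0 lt_max ltr01 orbT.
- by move=> y /ball_le /ball_S.
- move=> x Sx; have xr := S_ball x Sx; rewrite /cball /= in xr *.
  have xM : `|x - a| <= M.
    rewrite -lee_fin; apply: le_trans diam; apply: ereal_sup_ubound.
    by exists (x, a).
  have [_|_] := leP r (Num.max M 1); first exact: xr.
  apply: (le_trans xM); apply: (@le_trans _ _ (Num.max M 1)).
    by rewrite le_max lexx.
  by rewrite ler_peMl// le_max ler01 orbT.
- by move=> y /ball_le; exact: star.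
Qed.

Lemma dyadic_level (R : realType) (M r : R) : 0 < r -> r <= M ->
  exists n, 2 ^+ n * r <= M < 2 ^+ n.+1 * r.
Proof.
move=> r_gt0 rM.
have ex_n : exists n, M < 2 ^+ n * r.
  exists (Num.bound (M / r)); rewrite -ltr_pdivrMr//.
  exact: upper_nthrootP (leqnn _).
(* The least exponent with [M < 2 ^+ n * r] is positive because [r <= M]; its predecessor is the
   level. *)
case: (ex_minnP ex_n) => -[|n] Mn n_min; first by rewrite mul1r ltNge rM in Mn.
exists n; rewrite Mn andbT leNgt; apply/negP => /n_min.
by rewrite ltnn.
Qed.

(** * Selection, colouring and covering *)

Theorem mainTheorem3
  (R : realType) (X : normedModType R) (d : nat) (dimX : Vector.axiom d X)
  (N NS : R -> nat)
  (N_bound : forall gamma : R, 1 <= gamma -> ball_packing_bound X gamma (N gamma))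
  (NS_bound : forall gamma : R, 1 <= gamma -> sphere_packing_bound X gamma (NS gamma))
  (lambda : R) (lambda_ge1 : 1 <= lambda)
  (A : set X) (S : X -> set X)
  (S_lambda : forall a : X, A a -> Slambda lambda a (S a))
  (S_diam : exists M : R, forall a : X, A a -> (diameter (S a) <= M%:E)%E) :
  exists (m : nat) (A_ : 'I_m -> set X),
    [/\ (m <= kappa N NS lambda)%N,
        forall j : 'I_m, A_ j `<=` A,
        trivIset setT A_,
        A `<=` \bigcup_(j : 'I_m) \bigcup_(a in A_ j) interior (S a)
      & forall j : 'I_m, trivIset (A_ j) S].
Proof.
have [M diam_le_M] := S_diam.
have /choice[r r_inner] a : exists r, A a ->
    inner_radius lambda (S a) a r /\ r <= Num.max M 1.
  have [Aa|nAa] := pselect (A a); last by exists 0.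
  have [r ? ?] := Slambda_bounded_radius _ _ _ _ _ _ lambda_ge1
    (S_lambda a Aa) (diam_le_M a Aa).
  by exists r.
have /choice[lev levP] a : exists n, A a ->
    2 ^+ n * r a <= Num.max M 1 < 2 ^+ n.+1 * r a.
  have [Aa|nAa] := pselect (A a); last by exists 0%N.
  have [[r_gt0 _ _ _] rM] := r_inner a Aa.
  by have [n] := dyadic_level _ _ _ r_gt0 rM; exists n.
have [prec [prec_wf prec_total prec_lev]] := level_wf_order X lev.
(* Levels do not decrease along [prec], so [2 ^+ lev a * r b <= 2 ^+ lev b * r b <= Num.max M 1 < 2
   ^+ (lev a).+1 * r a]. *)
have prec_r a b : A a -> A b -> prec a b -> r b <= 2 * r a.
  move=> Aa Ab /prec_lev lev_ab.
  have /andP[_ Ma] := levP a Aa; have /andP[Mb _] := levP b Ab.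
  have [[rb_gt0 _ _ _] _] := r_inner b Ab.
  rewrite -(ler_pM2l (exprn_gt0 (lev a) (ltr0n R 2))) mulrA -exprSr.
  apply: le_trans (ltW Ma); apply: le_trans Mb.
  by rewrite ler_pM2r// ler_weXn2l// ler1n.
have [B BP] := wf_kernel X prec (fun b a => interior (S b) a) A prec_wf.
have BA a : B a -> A a by move=> /BP[].
have B_precedes a b : B a -> B b -> prec a b -> precedes S r a b.
  move=> Ba Bb ab; split; last exact: prec_r (BA a Ba) (BA b Bb) ab.
  by have /BP[_ /(_ a)] := Bb; apply.
have inner a : B a -> inner_radius lambda (S a) a (r a).
  by move=> /BA/r_inner[].
have kappa_gt0 : (0 < kappa N NS lambda)%N.
  rewrite /kappa addn_gt0; apply/orP; left.
  have g_ge1 : 1 <= 64 * lambda ^+ 3 by rewrite mulr_ege1 ?ler1n ?exprn_ege1.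
  apply: (scaled_ball_packing R X _ _ 0 1 [::] (N_bound _ g_ge1)) => //.
  exact: lt_le_trans g_ge1.
(* Only selected points conflict; the colours of the others are irrelevant. *)
pose conflict a b := [/\ B a, B b & S a `&` S b !=set0].
have [c [c_lt cP]] : exists c : X -> nat,
    (forall a, (c a < kappa N NS lambda)%N) /\
    forall a b, prec a b -> conflict a b -> c a <> c b.
  apply: wf_coloring prec_wf _ => p s s_uniq sP.
  (* A nonempty [s] shows that [p] is selected; an empty one only needs [kappa] to be positive. *)
  have [->|[a0 a0s]] : s = [::] \/ exists a, a \in s.
  - by case: (s) => [|x s']; [left|right; exists x; exact: mem_head].
  - exact: kappa_gt0.
  have Bp : B p by have [_ []] := sP a0 a0s.
  have sB a : a \in s -> B a by move=> /sP[_ []].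
  apply: (satellite_bound lambda S r lambda_ge1 N NS p s N_bound NS_bound) => //.
  - exact: inner.
  - by move=> a /sB/inner.
  - by move=> a a_s; apply: B_precedes (sB a a_s) Bp _; have [] := sP a a_s.
  - by move=> a /sP[_ []].
  - move=> a b a_s bs /prec_total[ab|ba]; [left|right];
      by apply: B_precedes => //; exact: sB.
exists (kappa N NS lambda), (fun j => [set a | B a /\ c a = j]); split => //.
- by move=> j a [/BA].
- by move=> i j _ _ [a [[_ ci] [_ cj]]]; apply: val_inj; rewrite /= -ci -cj.
- move=> a Aa.
  suff [b Bb ab] : exists2 b, B b & interior (S b) a.
    by exists (Ordinal (c_lt b)) => //; exists b.
  (* A point outside all selected interiors would itself be selected, and it lies in the interior of
     its own set. *)
  apply: contrapT => a_out; apply: (a_out); exists a.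
    apply/BP; split=> // b ab Bb a_in; apply: a_out; by exists b.
  have [[r_gt0 ball_S _ _] _] := r_inner a Aa.
  apply: contrapT => /(notin_interior_dist (proj1 (r_inner a Aa))).
  by rewrite subrr normr0 leNgt r_gt0.
- move=> j a b [Ba ca] [Bb cb] meet; apply: contrapT => /eqP /prec_total.
  have meetC : S b `&` S a !=set0 by rewrite setIC.
  by move=> [ab|ba]; [apply: (cP a b)|apply: (cP b a)]; rewrite ?ca ?cb.
Qed.
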